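(* Let $\mathcal H$ be a finite-dimensional Hilbert space and let $V$ be the real vector space of Hermitian operators on $\mathcal H$. The norms $\|\cdot\|_{\mathbf M}$ on $V$ associated to separating sets $\mathbf M$ of POVMs on $\mathcal H$ are in one-to-one correspondence with the full-dimensional symmetric closed convex bodies $\mathbb M\subset V$ satisfying $\pm\mathbb 1\in\mathbb M\subseteq[-\mathbb 1;\mathbb 1]$, the correspondence being given by $$\|\xi\|_{\mathbf M}=\max_{M\in\mathbb M}\operatorname{Tr}(\xi M)\qquad(\xi\in V).$$ As a consequence, any norm $|||\cdot|||$ on $V$ with $|||\cdot|||\le\|\cdot\|_1$ can be written as $|||\cdot|||=\|\cdot\|_{\mathbf M}$ for some set $\mathbf M$ of POVMs.
   Context: POVMs are discrete: finite families $(M_k)_{k=1}^n$ of positive semidefinite operators on $\mathcal H$ with $\sum_kM_k=\mathbb 1$. For a set $\mathbf M$ of POVMs, $\|\xi\|_{\mathbf M}=\sup_{(M_k)\in\mathbf M}\sum_k|\operatorname{Tr}(\xi M_k)|$. $\mathbf M$ is separating (informationally complete) if for every $\xi\ne0$ there are $(M_k)\in\mathbf M$ and an index $k_0$ with $\operatorname{Tr}(\xi M_{k_0})\ne0$; this is exactly the condition for $\|\cdot\|_{\mathbf M}$ to be a norm. $\|\cdot\|_1$ is the trace norm. $[-\mathbb 1;\mathbb 1]=\{X\in V:-\mathbb 1\le X\le\mathbb 1\}$. A set $\mathbb M$ is symmetric if $\mathbb M=-\mathbb M$, and full-dimensional if it has nonempty interior in $V$.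
   Formalization: The final consequence also assumes |Tr ξ| ≤ |||ξ||| for all ξ in V; without it the claim fails, e.g. half the trace norm equals 1/2 on density operators, where any nonempty set of POVMs gives 1. *)

(* Defs.v *)
From HB Require Import structures.
From mathcomp Require Import all_boot all_order all_algebra.
From mathcomp Require Import complex.
From mathcomp Require Import mathcomp_extra boolp classical_sets functions reals.
From mathcomp Require Import topology normedtype convex.
From mathcomp Require Import ring lra.

Set Implicit Arguments.
Unset Strict Implicit.
Unset Printing Implicit Defensive.

Import Order.TTheory GRing.Theory Num.Theory.
Import numFieldNormedType.Exports.
Local Open Scope classical_set_scope.
Local Open Scope ring_scope.
Local Open Scope sesquilinear_scope.

(* The Hilbert space is C^d, where C is the field R[i] over the real numbers R.
   The case d = 0 is included. The Hermitian matrices form a vector space over R. *)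

Definition herm_pred (R : realType) (d : nat) : pred 'M[complex R]_d :=
  fun A => A \is hermsymmx.

Section HermPred.
Variables (R : realType) (d : nat).

Lemma herm_predP (A : 'M[complex R]_d) : reflect (A = A ^t*) (A \in @herm_pred R d).
Proof.
by apply: (iffP (is_hermitianmxP _ _ _)); rewrite expr0 scale1r.
Qed.

Lemma herm_pred_zmod : zmod_closed (@herm_pred R d).
Proof.
split=> [|A B /herm_predP hA /herm_predP hB].
  by apply/herm_predP; rewrite trmx0 map_mx0.
by apply/herm_predP; rewrite linearB /= map_mxB -hA -hB.
Qed.

HB.instance Definition _ :=
  GRing.isZmodClosed.Build 'M[complex R]_d (@herm_pred R d) herm_pred_zmod.

Lemma herm_pred_scale (a : R) (A : 'M[complex R]_d) :
  A \in @herm_pred R d -> a%:C%C *: A \in @herm_pred R d.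
Proof.
move=> /herm_predP hA; apply/herm_predP/matrixP => i j; rewrite !mxE rmorphM /=.
have -> : ((a%:C%C)^*)%R = a%:C%C :> complex R.
  by apply/CrealP/complex_realP; exists a.
by congr (_ * _); have /matrixP/(_ i j) := hA; rewrite !mxE.
Qed.

Lemma herm_pred1 : 1%:M \in @herm_pred R d.
Proof. by apply/herm_predP; rewrite trmx1 map_mx1. Qed.

End HermPred.

Record herm (R : realType) (d : nat) :=
  Herm { hermmx :> 'M[complex R]_d; _ : hermmx \in @herm_pred R d }.

HB.instance Definition _ (R : realType) (d : nat) := [isSub for @hermmx R d].
HB.instance Definition _ (R : realType) (d : nat) := [Choice of herm R d by <:].
HB.instance Definition _ (R : realType) (d : nat) :=
  [SubChoice_isSubZmodule of herm R d by <:].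

Definition herm1 (R : realType) (d : nat) : herm R d := Herm (@herm_pred1 R d).

Section HermModule.
Variables (R : realType) (d : nat).
Implicit Types (X Y Z : herm R d) (a b : R).

Lemma herm_inP X : hermmx X \in @herm_pred R d.
Proof. by case: X. Qed.

Definition herm_scale a X : herm R d := Herm (herm_pred_scale a (herm_inP X)).

Lemma herm_scaleA a b X : herm_scale a (herm_scale b X) = herm_scale (a * b) X.
Proof. by apply/val_inj; rewrite /= scalerA rmorphM. Qed.

Lemma herm_scale1 : left_id 1 herm_scale.
Proof. by move=> X; apply/val_inj; rewrite /= scale1r. Qed.

Lemma herm_scaleDr : right_distributive herm_scale +%R.
Proof. by move=> a X Y; apply/val_inj; rewrite /= scalerDr. Qed.

Lemma herm_scaleDl X : {morph herm_scale^~ X : a b / a + b}.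
Proof. by move=> a b; apply/val_inj; rewrite /= rmorphD scalerDl. Qed.

HB.instance Definition _ := GRing.Zmodule_isLmodule.Build R (herm R d)
  herm_scaleA herm_scale1 herm_scaleDr herm_scaleDl.

(* Tr(X Y), which is a real number for Hermitian X and Y. *)
Definition trprod X Y : R := complex.Re (\tr (hermmx X *m hermmx Y)).

Lemma trprodC X Y : trprod X Y = trprod Y X.
Proof. by rewrite /trprod mxtrace_mulC. Qed.

Lemma trprodDl X Y Z : trprod (X + Y) Z = trprod X Z + trprod Y Z.
Proof. by rewrite /trprod /= mulmxDl mxtraceD raddfD. Qed.

Lemma trprodZl a X Y : trprod (a *: X) Y = a * trprod X Y.
Proof.
by rewrite /trprod /= -scalemxAl mxtraceZ; case: (\tr _) => u v /=; rewrite mul0r subr0.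
Qed.

Lemma trprodDr X Y Z : trprod X (Y + Z) = trprod X Y + trprod X Z.
Proof. by rewrite trprodC trprodDl !(trprodC _ X). Qed.

Lemma trprodZr a X Y : trprod X (a *: Y) = a * trprod X Y.
Proof. by rewrite trprodC trprodZl trprodC. Qed.

Lemma trprodXX X : trprod X X =
  \sum_i \sum_j (complex.Re (hermmx X i j) ^+ 2 + complex.Im (hermmx X i j) ^+ 2).
Proof.
rewrite /trprod /mxtrace raddf_sum /=; apply: eq_bigr => i _.
rewrite mxE raddf_sum /=; apply: eq_bigr => j _.
have /herm_predP/matrixP/(_ j i) := herm_inP X; rewrite !mxE => ->.
by case: (hermmx X i j) => u v /=; ring.
Qed.

Lemma trprodXX_ge0 X : 0 <= trprod X X.
Proof.
rewrite trprodXX; apply: sumr_ge0 => i _; apply: sumr_ge0 => j _.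
by rewrite addr_ge0 ?sqr_ge0.
Qed.

Lemma trprodXX_eq0 X : trprod X X = 0 -> X = 0.
Proof.
rewrite trprodXX => /eqP.
have P i : 0 <= \sum_j
    (complex.Re (hermmx X i j) ^+ 2 + complex.Im (hermmx X i j) ^+ 2).
  by apply: sumr_ge0 => j _; rewrite addr_ge0 ?sqr_ge0.
rewrite psumr_eq0 => [|i _]; last exact: P.
move=> /allP h; apply/val_inj/matrixP => i j; rewrite /= mxE.
have := h i (mem_index_enum i); rewrite /= psumr_eq0 => [|k _]; last first.
  by rewrite addr_ge0 ?sqr_ge0.
move=> /allP/(_ j (mem_index_enum j)) /=.
rewrite paddr_eq0 ?sqr_ge0 // !sqrf_eq0 => /andP[/eqP u0 /eqP v0].
by case: (hermmx X i j) u0 v0 => u v /= -> ->.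
Qed.

Definition hsnorm X : R := Num.sqrt (trprod X X).

Lemma trprod_CS X Y : trprod X Y <= hsnorm X * hsnorm Y.
Proof.
have [Y0|Y0] := eqVneq (trprod Y Y) 0.
  by rewrite (trprodXX_eq0 Y0) /hsnorm -(scale0r 0) !trprodZr !mul0r sqrtr0 mulr0.
have Yp : 0 < trprod Y Y by rewrite lt0r Y0 trprodXX_ge0.
have := trprodXX_ge0 (trprod Y Y *: X + (- trprod X Y) *: Y).
rewrite !trprodDr !trprodDl !trprodZr !trprodZl (trprodC Y X) => h.
have {}h : trprod X Y ^+ 2 <= trprod X X * trprod Y Y.
  rewrite -subr_ge0 -(pmulr_rge0 _ Yp); apply: le_trans h _.
  by rewrite le_eqVlt; apply/orP; left; apply/eqP; ring.
rewrite /hsnorm -sqrtrM ?trprodXX_ge0 //; apply: le_trans (ler_norm _) _.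
by rewrite -sqrtr_sqr ler_wsqrtr.
Qed.

Lemma ler_hsnormD X Y : hsnorm (X + Y) <= hsnorm X + hsnorm Y.
Proof.
have p : 0 <= hsnorm X + hsnorm Y by rewrite addr_ge0 ?sqrtr_ge0.
rewrite -(ger0_norm p) -sqrtr_sqr ler_wsqrtr // sqrrD.
rewrite !sqr_sqrtr ?trprodXX_ge0 // !trprodDr !trprodDl (trprodC Y X).
by have := trprod_CS X Y; lra.
Qed.

Lemma hsnormZ a X : hsnorm (a *: X) = `|a| * hsnorm X.
Proof.
by rewrite /hsnorm trprodZl trprodZr mulrA -expr2 sqrtrM ?sqr_ge0 // sqrtr_sqr.
Qed.

Lemma hsnorm0_eq0 X : hsnorm X = 0 -> X = 0.
Proof.
move=> /eqP; rewrite sqrtr_eq0 => h; apply: trprodXX_eq0; apply/eqP.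
by rewrite eq_le h trprodXX_ge0.
Qed.

(* V is normed by the Hilbert-Schmidt norm, which is used only for its topology:
   V is finite-dimensional, so every norm on V induces the same one. *)
HB.instance Definition _ := Lmodule_isNormed.Build R (herm R d)
  ler_hsnormD hsnormZ hsnorm0_eq0.

End HermModule.

Definition psd (R : realType) (d : nat) (X : herm R d) : Prop :=
  forall u : 'cV[complex R]_d, 0 <= (u ^t* *m hermmx X *m u) 0 0.

Record povm (R : realType) (d : nat) := Povm {
  povm_size : nat;
  effect : 'I_povm_size -> herm R d;
  effect_psd : forall k, psd (effect k);
  effect_sum : \sum_k effect k = herm1 R d }.

Arguments effect {R d} p k.

Section Definitions.
Variables (R : realType) (d : nat).
Local Notation V := (herm R d).

Definition op_le (X Y : V) : Prop := psd (Y - X).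

Definition povm_norm (MM : set (povm R d)) (xi : V) : R :=
  sup [set \sum_k `|trprod xi (effect E k)| | E in MM].

Definition separating (MM : set (povm R d)) : Prop :=
  forall xi : V, xi != 0 ->
    exists2 E, MM E & exists k, trprod xi (effect E k) != 0.

Definition povm_norms : set (V -> R) :=
  [set povm_norm MM | MM in separating].

Definition unit_interval : set V :=
  [set X | op_le (- herm1 R d) X /\ op_le X (herm1 R d)].

Definition symmetric_set (K : set V) : Prop := K = -%R @` K.

Definition full_dimensional (K : set V) : Prop := K° !=set0.

Definition measurement_bodies : set (set V) :=
  [set K | [/\ full_dimensional K, symmetric_set K, closed K,
               convex_set (K : set (convex_lmodType V)) &
               [/\ K (herm1 R d), K (- herm1 R d) & K `<=` unit_interval]]].

Definition is_max (S : set R) (m : R) : Prop := S m /\ ubound S m.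

(* The supremum is attained on measurement_bodies, cf. is_max. *)
Definition body_norm (K : set V) (xi : V) : R := sup [set trprod xi M | M in K].

(* The positive square root of a positive semidefinite A, by functional calculus
   on the spectral decomposition A = P^-1 diag(sp) P, with P unitary. *)
Definition mxsqrt (A : 'M[complex R]_d) : 'M[complex R]_d :=
  invmx (spectralmx A) *m diag_mx (map_mx sqrtC (spectral_diag A))
    *m spectralmx A.

Definition trnorm (X : V) : R :=
  complex.Re (\tr (mxsqrt ((hermmx X) ^t* *m hermmx X))).

Definition is_norm (N : V -> R) : Prop :=
  [/\ forall X Y, N (X + Y) <= N X + N Y,
      forall (a : R) X, N (a *: X) = `|a| * N X
    & forall X, N X = 0 -> X = 0].

End Definitions.

(* Main.v *)
(* The norm N of a separating set of POVMs yields the dual ball K = {M : Tr(xi M) <= N(xi)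
   for all xi}. It contains 1 and -1 because the effects of a POVM sum to 1, and it
   lies in [-1; 1] because N(u u^* ) = Tr(u u^* ); by the bipolar theorem, obtained from
   the nearest point projection for the Hilbert-Schmidt norm, N is the support
   function of K, and a closed convex set is determined by its support function.
   Conversely, for a body K the binary POVMs ((1 + M) / 2, (1 - M) / 2) with M in K
   give |Tr xi (1 + M) / 2| + |Tr xi (1 - M) / 2| = max(|Tr xi|, |Tr xi M|), whose
   maximum over K is the support function of K.
   Compactness and boundedness come from the fact that the operators u u^* span V,
   by polarization. *)
Require Import Defs.
From mathcomp Require Import all_boot all_order all_algebra.
From mathcomp Require Import complex.
From mathcomp Require Import mathcomp_extra boolp classical_sets functions reals.
From mathcomp Require Import topology normedtype convex.
From mathcomp Require Import interval_inference derive ring lra.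

Import Order.TTheory GRing.Theory Num.Theory.
Import numFieldNormedType.Exports.
Local Open Scope classical_set_scope.
Local Open Scope ring_scope.

Set Implicit Arguments.
Unset Strict Implicit.
Unset Printing Implicit Defensive.

(** * Auxiliary facts of real analysis *)

Section Analysis.
Context {R : realType}.

Lemma lipschitz_continuous_fun (V : normedModType R) (f : V -> R) (k : R) :
  (forall x y, `|f x - f y| <= k * `|x - y|) -> continuous f.
Proof.
move=> fk x; apply/cvgrPdist_lt => e e0.
have k1 : 0 < `|k| + 1 by rewrite ltr_wpDl.
near=> y; apply: le_lt_trans (fk x y) _.
apply: (@le_lt_trans _ _ ((`|k| + 1) * `|x - y|)).
  by rewrite ler_wpM2r // (le_trans (ler_norm k)) // lerDl.
rewrite mulrC -ltr_pdivlMr //.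
near: y; have /cvgrPdist_lt := @cvg_id _ (nbhs x).
by apply; rewrite divr_gt0.
Unshelve. all: by end_near. Qed.

(** First-order optimality: if [a > 0], the single value [t = a / (a + m)] already violates the
    inequality, so no limit [t -> 0] is taken. *)
Lemma quadratic_le0 (a m : R) : 0 <= m ->
  (forall t, 0 <= t <= 1 -> 2 * t * a <= t ^+ 2 * m) -> a <= 0.
Proof.
move=> m0 key; rewrite leNgt; apply/negP => a0.
have am : 0 < a + m by rewrite ltr_pwDl.
have t0 : 0 < a / (a + m) by rewrite divr_gt0.
have t1 : a / (a + m) <= 1 by rewrite ler_pdivrMr // mul1r lerDl.
have := key (a / (a + m)); rewrite (ltW t0) t1 => /(_ isT).
have -> : 2 * (a / (a + m)) * a = a / (a + m) * (2 * a) by ring.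
have -> : (a / (a + m)) ^+ 2 * m = a / (a + m) * (a / (a + m) * m) by ring.
rewrite ler_pM2l // mulrAC ler_pdivlMr //.
by apply/negP; rewrite -ltNge; nra.
Qed.

(** Source of compactness in [V]: by induction, the set for [i :: s] is the image of a segment times
    [C] under [(a, X) -> a *: e i + X]. *)
Lemma compact_bounded_combinations (V : normedModType R) (I : Type) (s : seq I)
    (e : I -> V) (r : R) :
  exists2 C : set V, compact C &
    forall c : I -> R, (forall i, `|c i| <= r) -> C (\sum_(i <- s) c i *: e i).
Proof.
elim: s => [|i s [C cC hC]].
  by exists [set 0]; [exact: compact_set1 | move=> c _; rewrite big_nil].
exists [set p.1 *: e i + p.2 | p in `[- r, r]%classic `*` C].
  apply: continuous_compact; last exact: compact_setX (@segment_compact _ _ _) cC.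
  apply: continuous_subspaceT => p; apply: cvgD; last exact: cvg_snd.
  by apply: cvgZr_tmp; exact: cvg_fst.
move=> c cr; rewrite big_cons.
exists (c i, \sum_(j <- s) c j *: e j) => //; split=> /=; last exact: hC.
by rewrite in_itv /= -ler_norml.
Qed.

End Analysis.

Section Herm.
Context {R : realType} {d : nat}.
Local Notation V := (herm R d).
Local Notation C := (complex R).
Local Notation I1 := (herm1 R d).
Local Open Scope sesquilinear_scope.
Implicit Types (X Y Z : V) (u v : 'cV[C]_d).

(** * The trace pairing as an inner product *)

Lemma trprodNl X Y : trprod (- X) Y = - trprod X Y.
Proof. by rewrite -scaleN1r trprodZl mulN1r. Qed.

Lemma trprodNr X Y : trprod X (- Y) = - trprod X Y.
Proof. by rewrite trprodC trprodNl trprodC. Qed.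

Lemma trprodBl X Y Z : trprod (X - Y) Z = trprod X Z - trprod Y Z.
Proof. by rewrite trprodDl trprodNl. Qed.

Lemma trprodBr X Y Z : trprod X (Y - Z) = trprod X Y - trprod X Z.
Proof. by rewrite trprodDr trprodNr. Qed.

Lemma trprod0r X : trprod X 0 = 0.
Proof. by rewrite -(subrr X) trprodBr subrr. Qed.

Lemma trprod_sumr (I : Type) (s : seq I) (F : I -> V) X :
  trprod X (\sum_(i <- s) F i) = \sum_(i <- s) trprod X (F i).
Proof.
elim: s => [|i s IH]; first by rewrite !big_nil trprod0r.
by rewrite !big_cons trprodDr IH.
Qed.

Lemma trprod_le_norm X Y : `|trprod X Y| <= `|X| * `|Y|.
Proof.
rewrite ler_norml; apply/andP; split; last exact: trprod_CS.
by rewrite lerNl -trprodNl -(normrN X); exact: trprod_CS.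
Qed.

Lemma norm_trprodXX X : `|X| ^+ 2 = trprod X X.
Proof. by rewrite sqr_sqrtr // trprodXX_ge0. Qed.

Lemma trprodl_continuous X : continuous (fun Y => trprod Y X).
Proof.
apply: (lipschitz_continuous_fun (k := `|X|)) => Y Z.
by rewrite -trprodBl mulrC; exact: trprod_le_norm.
Qed.

Lemma trprod_ext X Y : (forall Z, trprod Z X = trprod Z Y) -> X = Y.
Proof.
move=> h; apply/eqP; rewrite -subr_eq0; apply/eqP/trprodXX_eq0.
by rewrite trprodBr h subrr.
Qed.

(** * Rank-one operators, positivity and polarization *)

Lemma rank1_herm u : u *m u^t* \in @herm_pred R d.
Proof.
apply/herm_predP; rewrite trmx_mul map_mxM.
by rewrite trmxCK.
Qed.

Definition rank1 u : V := Herm (rank1_herm u).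

Lemma trprod_rank1 X u : trprod X (rank1 u) = complex.Re ((u^t* *m hermmx X *m u) 0 0).
Proof. by rewrite /trprod /= mulmxA mxtrace_mulC mulmxA /mxtrace big_ord1. Qed.

Lemma quadratic_form_real X u : complex.Im ((u^t* *m hermmx X *m u) 0 0) = 0.
Proof.
have /herm_predP hX := herm_inP X.
have : u^t* *m hermmx X *m u = (u^t* *m hermmx X *m u)^t*.
  by rewrite !trmx_mul !map_mxM trmxCK -hX mulmxA.
move=> /matrixP/(_ 0 0); rewrite [RHS]mxE [in RHS]mxE.
by case: (_ 0 0) => a b [] /=; lra.
Qed.

(** The order on [complex R] also compares imaginary parts; these vanish for Hermitian forms, so
    positivity becomes a family of real inequalities. *)
Lemma psdP X : psd X <-> forall u, 0 <= trprod X (rank1 u).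
Proof.
split=> h u; have := h u; rewrite trprod_rank1 lecE quadratic_form_real /=.
  by case/andP.
by move=> ->; rewrite eqxx.
Qed.


(** This is [u v^* + v u^*], written so that it visibly lies in the span of the rank-one
    operators. *)
Definition polar u v : V := rank1 (u + v) - rank1 u - rank1 v.

Lemma ReD (a b : C) : complex.Re (a + b) = complex.Re a + complex.Re b.
Proof. by case: a b => [? ?] []. Qed.

Let form X u v := complex.Re ((u^t* *m hermmx X *m v) 0 0).

Let formDl X u v w : form X (u + v) w = form X u w + form X v w.
Proof.
by rewrite /form [(u + v)^T]linearD map_mxD !mulmxDl [fun_of_matrix (_ + _) _ _]mxE ReD.
Qed.

Let formDr X u v w : form X u (v + w) = form X u v + form X u w.
Proof. by rewrite /form mulmxDr [fun_of_matrix (_ + _) _ _]mxE ReD. Qed.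

Let formC X u v : form X u v = form X v u.
Proof.
have /herm_predP hX := herm_inP X; rewrite /form.
have : u^t* *m hermmx X *m v = (v^t* *m hermmx X *m u)^t*.
  by rewrite !trmx_mul !map_mxM trmxCK -hX mulmxA.
move=> /matrixP/(_ 0 0); rewrite [RHS]mxE [in RHS]mxE => ->.
by case: (_ 0 0).
Qed.

Lemma trprod_polar X u v :
  trprod X (polar u v) = 2 * complex.Re ((u^t* *m hermmx X *m v) 0 0).
Proof.
have E w : trprod X (rank1 w) = form X w w by exact: trprod_rank1.
rewrite -/(form X u v) /polar (trprodBr X (_ - _)) (trprodBr X (rank1 _)) !E.
rewrite formDl 2!formDr (formC X v u).
by move: (form X u u) (form X u v) (form X v v) => a b c; ring.
Qed.

Lemma delta_form (A : 'M[C]_d) i j (a : C) :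
  ((delta_mx i 0 : 'M[C]_(d, 1))^t* *m A *m (a *: delta_mx j 0 : 'M[C]_(d, 1))) 0 0 =
  a * A i j.
Proof.
rewrite -scalemxAr mxE; congr (_ * _).
rewrite trmx_delta map_delta_mx -rowE -colE.
by rewrite !mxE.
Qed.

(** Pairing [X] with the two operators indexed by [(i, j)] reads off twice the real part and minus
    twice the imaginary part of the entry [X i j]. All pairs are kept: the family is redundant, but
    it is a tight frame, which spares the choice of a basis. *)
Definition polar_frame (k : 'I_d * 'I_d * bool) : V :=
  polar (delta_mx k.1.1 0) ((if k.2 then Complex 0 1 else 1) *: delta_mx k.1.2 0).

Lemma trprod_polar_frame_entry X i j b : trprod X (polar_frame (i, j, b)) =
  2 * complex.Re ((if b then Complex 0 1 else 1) * hermmx X i j).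
Proof. by rewrite trprod_polar delta_form. Qed.

Lemma trprodE X Y : trprod X Y =
  \sum_i \sum_j (complex.Re (hermmx X i j) * complex.Re (hermmx Y i j)
               + complex.Im (hermmx X i j) * complex.Im (hermmx Y i j)).
Proof.
rewrite /trprod /mxtrace raddf_sum /=; apply: eq_bigr => i _.
rewrite mxE raddf_sum /=; apply: eq_bigr => j _.
have /herm_predP/matrixP/(_ j i) := herm_inP Y; rewrite !mxE => ->.
by case: (hermmx X i j) => u v; case: (hermmx Y i j) => u' v' /=; ring.
Qed.

(** Parseval identity of the tight frame: at each entry the two values of the Boolean supply the
    products of real and of imaginary parts, each with factor 4. *)
Lemma trprod_polar_frame X Y :
  \sum_k trprod X (polar_frame k) * trprod Y (polar_frame k) = 4 * trprod X Y.
Proof.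
rewrite trprodE !pair_bigA /= mulr_sumr.
rewrite (eq_bigr (fun k => (fun p b => trprod X (polar_frame (p, b)) *
   trprod Y (polar_frame (p, b))) k.1 k.2)); last by case.
rewrite -(pair_bigA _ (fun p b => trprod X (polar_frame (p, b)) *
   trprod Y (polar_frame (p, b)))) /=.
apply: eq_bigr => -[i j] _; rewrite big_bool /=.
rewrite !trprod_polar_frame_entry /=.
case: (hermmx X i j) => u v; case: (hermmx Y i j) => u' v' /=.
by rewrite !mul0r !mul1r; ring.
Qed.

Lemma polar_frame_decomposition X :
  X = \sum_k (4^-1 * trprod X (polar_frame k)) *: polar_frame k.
Proof.
apply: trprod_ext => Z; rewrite trprod_sumr.
under eq_bigr do rewrite trprodZr -mulrA.
by rewrite -mulr_sumr trprod_polar_frame mulrA mulVf ?mul1r // trprodC.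
Qed.

(** Serves to extend uniform bounds to all of [V] from the operators [u u^*], where positivity makes
    them immediate. *)
Lemma rank1_span_ind (P : V -> Prop) :
  P 0 -> (forall X Y, P X -> P Y -> P (X + Y)) ->
  (forall a X, P X -> P (a *: X)) -> (forall u, P (rank1 u)) -> forall X, P X.
Proof.
move=> P0 PD PZ P1 X; rewrite [X]polar_frame_decomposition.
apply: (big_ind P) => // k _; apply: (PZ).
rewrite /polar_frame /polar.
rewrite -(scaleN1r (rank1 (delta_mx _ _))) -(scaleN1r (rank1 (_ *: _))).
by do 2![apply: (PD); last exact: PZ].
Qed.

(** * Compactness of closed bounded sets *)

Lemma closed_pointwise_bounded_compact (K : set V) : closed K ->
  (forall X, exists c, forall M, K M -> `|trprod M X| <= c) -> compact K.
Proof.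
move=> clK /choice[c hc].
(* One radius bounds all frame coefficients of all elements of [K]. The absolute values cover an
   empty [K], for which [c] may be negative. *)
have [B cB hB] := compact_bounded_combinations
  (index_enum ('I_d * 'I_d * bool)%type) polar_frame (\sum_k `|c (polar_frame k)|).
apply: (subclosed_compact clK cB) => M KM.
rewrite (polar_frame_decomposition M); apply: hB => k.
rewrite normrM ger0_norm ?invr_ge0 //.
apply: (@le_trans _ _ `|trprod M (polar_frame k)|).
  by rewrite ler_piMl // invf_le1 // ler1n.
apply: (le_trans (hc _ _ KM)); apply: le_trans (ler_norm _) _.
by rewrite (bigD1 k) //= lerDl sumr_ge0.
Qed.

Lemma bounded_closed_compact_herm (K : set V) (r : R) :
  closed K -> (forall M, K M -> `|M| <= r) -> compact K.
Proof.
move=> clK Kr; apply: closed_pointwise_bounded_compact => // X.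
exists (r * `|X|) => M KM; apply: le_trans (trprod_le_norm _ _) _.
by rewrite ler_wpM2r // Kr.
Qed.

(** * Convexity and separation *)

Lemma convex_setP (K : set V) : convex_set (K : set (convex_lmodType V)) <->
  forall X Y (t : R), K X -> K Y -> 0 <= t <= 1 -> K (t *: X + (1 - t) *: Y).
Proof.
split=> [cK X Y t KX KY t01|cK X Y t /set_mem KX /set_mem KY].
  have t01' : Itv.spec (@Itv.num_sem R) (Itv.Real `[0%Z, 1%Z]) t.
    by rewrite /Itv.num_sem /= num_real in_itv /= .
  have := cK X Y (Itv.mk t01') (mem_set KX) (mem_set KY).
  by rewrite inE.
apply/mem_set/(cK X Y t%:num KX KY).
by apply/andP; split.
Qed.

Lemma ler_norm_trprod X Y : (`|X| <= `|Y|) = (trprod X X <= trprod Y Y).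
Proof. by rewrite ler_sqrt // trprodXX_ge0. Qed.

(* The separating functional is the displacement from [X] to its nearest point in
   [K]. *)
Lemma convex_separation (K : set V) X :
  closed K -> convex_set (K : set (convex_lmodType V)) -> K !=set0 -> ~ K X ->
  exists (Z : V) (b : R), (forall M, K M -> trprod Z M <= b) /\ b < trprod Z X.
Proof.
move=> clK cvK [M0 KM0] nKX.
have distc : continuous (fun M : V => `|X - M|).
  apply: (lipschitz_continuous_fun (k := 1)) => M M'; rewrite mul1r.
  apply: le_trans (ler_dist_dist _ _) _.
  by rewrite opprB addrC subrKA distrC.
(* [K] may be unbounded; its part no farther from [X] than [M0] is compact, and a minimizer of the
   distance there is one over all of [K]. *)
pose B : set V := (K : set V) `&` [set M | `|X - M| <= `|X - M0|].
have cB : compact B.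
  apply: (@bounded_closed_compact_herm _ (`|X| + `|X - M0|)).
    apply: closedI; first exact: clK.
    have /continuous_closedP h := distc.
    exact: (h [set r | r <= `|X - M0|] (@closed_le _ _)).
  move=> M [_ /= XM]; rewrite -(subKr X M); apply: le_trans (ler_normB _ _) _.
  by rewrite lerD2l.
have [P KP minP] : exists2 P : V, K P & forall M, K M -> `|X - P| <= `|X - M|.
  have [] := compact_EVT_min _ cB (continuous_subspaceT distc).
    by exists M0; split => /=.
  move=> P /set_mem[KP PX] minP; exists P; [exact: KP | move=> M KM].
  have [h|/ltW h] := leP `|X - M| `|X - M0|; last exact: le_trans h.
  by apply: minP; exact: mem_set.
have XP : 0 < `|X - P|.
  by rewrite normr_gt0 subr_eq0; apply/eqP => XP; apply: nKX; rewrite XP.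
exists (X - P), (trprod (X - P) P); split; last first.
  by rewrite -subr_gt0 -trprodBr -norm_trprodXX exprn_gt0.
(* Minimality of [P] along the segment from [P] to [M] bounds the linear term in [t] by the
   quadratic one, so the linear coefficient is nonpositive. *)
move=> M KM; rewrite -subr_le0 -trprodBr.
apply: quadratic_le0 (trprodXX_ge0 (M - P)) _ => t t01.
have := minP _ ((convex_setP K).1 cvK _ _ _ KM KP t01).
have -> : X - (t *: M + (1 - t) *: P) = (X - P) - t *: (M - P).
  by rewrite scalerBl scale1r addrCA -scalerBr opprD addrA.
rewrite ler_norm_trprod; move: (X - P) (M - P) => A B'.
rewrite trprodBl 2!trprodBr !trprodZl !trprodZr (trprodC B' A).
by move: (trprod A A) (trprod A B') (trprod B' B') => a b c; lra.
Qed.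

(** * Compactness of bodies and their support functions *)

Lemma trprod1_rank1 u : trprod I1 (rank1 u) = complex.Re ((u^t* *m u) 0 0).
Proof. by rewrite trprod_rank1 /= mulmx1. Qed.

Lemma trprod1_rank1_ge0 u : 0 <= trprod I1 (rank1 u).
Proof.
have : 0 <= (u^t* *m u) 0 0.
  rewrite mxE; apply: sumr_ge0 => i _.
  by rewrite !mxE mulrC mul_conjC_ge0.
by rewrite trprod1_rank1 lecE => /andP[].
Qed.

Lemma unit_interval_rank1 M u : unit_interval M ->
  `|trprod M (rank1 u)| <= trprod I1 (rank1 u).
Proof.
case=> /psdP/(_ u) + /psdP/(_ u); rewrite trprodBl trprodNl opprK trprodBl.
by rewrite ler_norml => h1 h2; apply/andP; split; lra.
Qed.

Lemma unit_interval_bounded X :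
  exists c, forall M, unit_interval M -> `|trprod M X| <= c.
Proof.
move: X; apply: rank1_span_ind => [|X Y [c hc] [c' hc']|a X [c hc]|u].
- by exists 0 => M _; rewrite trprod0r normr0.
- exists (c + c') => M hM; rewrite trprodDr; apply: le_trans (ler_normD _ _) _.
  by rewrite lerD ?hc ?hc'.
- by exists (`|a| * c) => M hM; rewrite trprodZr normrM ler_wpM2l // hc.
- by exists (trprod I1 (rank1 u)) => M; exact: unit_interval_rank1.
Qed.

Lemma body_compact (K : set V) : measurement_bodies K -> compact K.
Proof.
case=> _ _ clK _ [_ _ Ksub]; apply: closed_pointwise_bounded_compact => // X.
by have [c hc] := unit_interval_bounded X; exists c => M /Ksub; exact: hc.
Qed.

Lemma body_norm_max (K : set V) : measurement_bodies K -> forall xi : V,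
  is_max [set trprod xi M | M in K] (body_norm K xi).
Proof.
move=> bK xi; have [_ _ _ _ [K1 _ _]] := bK.
have [P /set_mem KP maxP] : exists2 P : V, P \in K &
    forall M : V, M \in K -> trprod M xi <= trprod P xi.
  apply: compact_EVT_max (body_compact bK) _; first by exists I1.
  exact/continuous_subspaceT/trprodl_continuous.
have ubP : ubound [set trprod xi M | M in K] (trprod xi P).
  by move=> _ [M KM <-]; rewrite !(trprodC xi) maxP //; exact: mem_set.
suff -> : body_norm K xi = trprod xi P by split=> //; exists P.
apply/eqP; rewrite eq_le; apply/andP; split.
  by apply: ge_sup => //; exists (trprod xi P), P.
by apply: ub_le_sup; [exists (trprod xi P) | exists P].
Qed.

Lemma ler_trprod_body_norm (K : set V) X M : measurement_bodies K -> K M ->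
  `|trprod X M| <= body_norm K X.
Proof.
move=> bK KM; have [_ ub] := body_norm_max bK X.
have [_ symK _ _ _] := bK.
have KN : K (- M) by rewrite symK; exists M.
rewrite ler_norml; apply/andP; split; last by apply: ub; exists M.
by rewrite lerNl -trprodNr; apply: ub; exists (- M).
Qed.

(** * Norms given by sets of POVMs *)

Lemma povm_sum_trprod (E : povm R d) X :
  \sum_k trprod X (effect E k) = trprod X I1.
Proof. by rewrite -trprod_sumr effect_sum. Qed.

(** Effects are positive, so the absolute values disappear and the sum is a trace, the same for
    every POVM. *)
Lemma povm_sum_rank1 (E : povm R d) u :
  \sum_k `|trprod (rank1 u) (effect E k)| = trprod I1 (rank1 u).
Proof.
rewrite trprodC -(povm_sum_trprod E); apply: eq_bigr => k _.
by rewrite ger0_norm // trprodC; have /psdP := effect_psd k; apply.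
Qed.

(** Makes the supremum in [povm_norm] a genuine one: [sup] of an unbounded set would be the default
    value 0. *)
Lemma povm_sum_bounded X :
  exists c, forall E : povm R d, \sum_k `|trprod X (effect E k)| <= c.
Proof.
move: X; apply: rank1_span_ind => [|X Y [c hc] [c' hc']|a X [c hc]|u].
- exists 0 => E; rewrite big1 // => k _.
  by rewrite trprodC trprod0r normr0.
- exists (c + c') => E; apply: le_trans (lerD (hc E) (hc' E)).
  rewrite -big_split /=; apply: ler_sum => k _.
  by rewrite trprodDl ler_normD.
- exists (`|a| * c) => E; under eq_bigr do rewrite trprodZl normrM.
  by rewrite -mulr_sumr ler_wpM2l // hc.
- by exists (trprod I1 (rank1 u)) => E; rewrite povm_sum_rank1.
Qed.

Lemma povm_norm_ub (MM : set (povm R d)) E X : MM E ->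
  \sum_k `|trprod X (effect E k)| <= povm_norm MM X.
Proof.
move=> ME; apply: ub_le_sup; last by exists E.
by have [c hc] := povm_sum_bounded X; exists c => _ [F _ <-].
Qed.

(* [0 <= c] is there for the empty set of POVMs, where [povm_norm] is [sup set0 = 0]. *)
Lemma povm_norm_le (MM : set (povm R d)) X c : 0 <= c ->
  (forall E, MM E -> \sum_k `|trprod X (effect E k)| <= c) -> povm_norm MM X <= c.
Proof.
move=> c0 hc; have [ne|e] := pselect ([set \sum_k `|trprod X (effect E k)| | E in MM] !=set0).
  by apply: ge_sup => // _ [E ME <-]; exact: hc.
rewrite /povm_norm sup_out //; by case.
Qed.

Lemma povm_norm_ge0 (MM : set (povm R d)) X : 0 <= povm_norm MM X.
Proof.
have [[E ME]|e] := pselect (MM !=set0).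
  by apply: le_trans (povm_norm_ub X ME); exact: sumr_ge0.
rewrite /povm_norm sup_out // => -[[_ [E ME _]] _]; by apply: e; exists E.
Qed.

Lemma povm_norm_is_norm (MM : set (povm R d)) :
  separating MM -> is_norm (povm_norm MM).
Proof.
move=> sepM.
have scale a X : povm_norm MM (a *: X) <= `|a| * povm_norm MM X.
  apply: povm_norm_le => [|E ME]; first by rewrite mulr_ge0 // povm_norm_ge0.
  under eq_bigr do rewrite trprodZl normrM.
  by rewrite -mulr_sumr ler_wpM2l // povm_norm_ub.
split=> [X Y|a X|X].
- apply: povm_norm_le => [|E ME]; first by rewrite addr_ge0 // povm_norm_ge0.
  apply: le_trans (lerD (povm_norm_ub X ME) (povm_norm_ub Y ME)).
  rewrite -big_split /=; apply: ler_sum => k _.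
  by rewrite trprodDl ler_normD.
(* The reverse inequality is [scale] for the factor [a^-1] and the operator [a *: X]. *)
- apply/eqP; rewrite eq_le scale /=; have [->|a0] := eqVneq a 0.
    by rewrite normr0 mul0r povm_norm_ge0.
  have := scale a^-1 (a *: X); rewrite scalerA mulVf // scale1r normfV.
  by rewrite ler_pdivlMl ?normr_gt0.
- move=> NX0; apply/eqP; apply: contraT => /sepM[E ME [k]].
  rewrite -normr_gt0 => kpos; have := povm_norm_ub X ME.
  by rewrite NX0 leNgt (bigD1 k) //= ltr_pwDl // sumr_ge0.
Qed.

Lemma povm_norm_trace (MM : set (povm R d)) X :
  separating MM -> `|trprod X I1| <= povm_norm MM X.
Proof.
(* A nonzero [X] yields a POVM in [MM]. For [X = 0] there may be none: when [d = 0] the empty set is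
   separating. *)
move=> sepM; have [->|/sepM[E ME _]] := eqVneq X 0.
  by rewrite trprodC trprod0r normr0 povm_norm_ge0.
apply: le_trans (povm_norm_ub X ME); rewrite -(povm_sum_trprod E).
exact: ler_norm_sum.
Qed.

Lemma povm_norm_rank1 (MM : set (povm R d)) u :
  povm_norm MM (rank1 u) <= trprod I1 (rank1 u).
Proof.
apply: povm_norm_le => [|E _]; last by rewrite povm_sum_rank1.
exact: trprod1_rank1_ge0.
Qed.

(** * Norms on [V] and their dual balls *)

Section Norm.
Variables (N : V -> R) (normN : is_norm N).

Let ND X Y : N (X + Y) <= N X + N Y. Proof. by case: normN. Qed.
Let NZ a X : N (a *: X) = `|a| * N X. Proof. by case: normN. Qed.
Let N0 : N 0 = 0. Proof. by rewrite -(scale0r 0) NZ normr0 mul0r. Qed.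
Let NN X : N (- X) = N X. Proof. by rewrite -scaleN1r NZ normrN1 mul1r. Qed.

Lemma is_norm_ge0 X : 0 <= N X.
Proof. by have := ND X (- X); rewrite subrr N0 NN; lra. Qed.

Lemma is_norm_sum (I : Type) (s : seq I) (F : I -> V) :
  N (\sum_(i <- s) F i) <= \sum_(i <- s) N (F i).
Proof.
elim: s => [|i s IH]; first by rewrite !big_nil N0.
by rewrite !big_cons; apply: le_trans (ND _ _) _; rewrite lerD2l.
Qed.

Lemma is_norm_le_hsnorm : exists k, forall X, N X <= k * `|X|.
Proof.
exists (\sum_k 4^-1 * (`|polar_frame k| * N (polar_frame k))) => X.
rewrite {1}[X]polar_frame_decomposition mulr_suml.
apply: le_trans (is_norm_sum _ _) _; apply: ler_sum => k _.
rewrite NZ normrM ger0_norm ?invr_ge0 // -!mulrA ler_pM2l ?invr_gt0 //.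
rewrite (mulrC (N _)) mulrA (mulrC `|polar_frame k|).
by apply: ler_wpM2r; [exact: is_norm_ge0 | exact: trprod_le_norm].
Qed.

Lemma is_norm_continuous : continuous N.
Proof.
have [k Nk] := is_norm_le_hsnorm.
apply: (lipschitz_continuous_fun (k := k)) => X Y; apply: le_trans (Nk (X - Y)).
rewrite ler_norml; apply/andP; split.
  by have := ND (X - Y) (- X); rewrite addrAC subrr add0r !NN; lra.
by have := ND (X - Y) Y; rewrite subrK; lra.
Qed.

(** The constant is the minimum of the continuous [N] on the compact Hilbert-Schmidt sphere,
    positive because [N] vanishes only at 0. *)
Lemma hsnorm_le_is_norm : exists2 c, 0 < c & forall X, c * `|X| <= N X.
Proof.
pose S : set V := [set X | `|X| = 1].
have cS : compact S.
  apply: (@bounded_closed_compact_herm _ 1); last by move=> M ->.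
  have /continuous_closedP h : continuous (fun X : V => `|X|) by exact: norm_continuous.
  exact: (h [set r | r = 1] (@closed_eq _ _)).
have normalize X : X != 0 -> S (`|X|^-1 *: X).
  move=> X0; rewrite /S /= normrZ normfV normr_id mulVf //.
  by rewrite normr_eq0.
(* The sphere is empty when [d = 0]; any constant then serves. *)
have [S0|S0] := pselect (S !=set0); last first.
  exists 1 => // X; have [->|X0] := eqVneq X 0; first by rewrite normr0 mulr0 N0.
  by exfalso; apply: S0; exists (`|X|^-1 *: X); exact: normalize.
have [P SP minP] : exists2 P : V, S P & forall X, S X -> N P <= N X.
  have [] := compact_EVT_min S0 cS (continuous_subspaceT is_norm_continuous).
  move=> P /set_mem SP minP; exists P; first exact: SP.
  by move=> X SX; apply: minP; exact: mem_set.
exists (N P).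
  rewrite lt0r is_norm_ge0 andbT; apply/eqP => NP0.
  have [_ _ /(_ P NP0) P0] := normN.
  by move: SP; rewrite /S /= P0 normr0 => /esym/eqP; rewrite oner_eq0.
move=> X; have [->|X0] := eqVneq X 0; first by rewrite normr0 mulr0 N0.
have := minP _ (normalize X X0); rewrite NZ normfV normr_id.
by rewrite ler_pdivlMl ?normr_gt0 // mulrC.
Qed.

Definition dual_ball : set V := [set M | forall X, trprod X M <= N X].

Lemma dual_ball_symmetric M : dual_ball M -> dual_ball (- M).
Proof. by move=> KM X; rewrite trprodNr -trprodNl -NN; exact: KM. Qed.

Lemma dual_ball_closed : closed dual_ball.
Proof.
have -> : dual_ball = \bigcap_(X in [set: V]) ((fun M => trprod M X) @^-1` [set r | r <= N X]).
  apply/seteqP; split=> [M KM X _|M KM X] /=; first by rewrite trprodC; exact: KM.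
  by have := KM X I; rewrite /= trprodC.
apply: closed_bigI => X _.
have /continuous_closedP h := @trprodl_continuous X.
exact: (h [set r | r <= N X] (@closed_le _ _)).
Qed.

Lemma dual_ball_convex : convex_set (dual_ball : set (convex_lmodType V)).
Proof.
apply/convex_setP => A B t KA KB /andP[t0 t1] X.
by rewrite trprodDr !trprodZr; have := KA X; have := KB X; nra.
Qed.

(** By Cauchy-Schwarz, the lower bound of [N] by [c] times the Hilbert-Schmidt norm puts the ball of
    radius [c] around 0 inside. *)
Lemma dual_ball_full : full_dimensional dual_ball.
Proof.
have [c c0 cN] := hsnorm_le_is_norm.
exists 0; apply/nbhs_ballP; exists c => //= M.
rewrite -ball_normE /= sub0r normrN => Mc X.
apply: le_trans (ler_norm _) _; apply: le_trans (trprod_le_norm _ _) _.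
apply: le_trans (cN X); rewrite mulrC ler_wpM2r //; exact: ltW.
Qed.

(** Bipolar theorem: if the support function at [X] were below [N X], a functional separating a
    multiple of [X] from the unit ball of [N] would, once normalized, lie in the dual ball and
    exceed the support function at [X]. *)
Lemma body_norm_dual_ball : forall X, measurement_bodies dual_ball ->
  body_norm dual_ball X = N X.
Proof.
move=> X bK; have [attained ub] := body_norm_max bK X.
apply/eqP; rewrite eq_le; apply/andP; split.
  by have [M KM <-] := attained; exact: KM.
rewrite leNgt; apply/negP => lt_body.
set b := body_norm _ X in attained ub lt_body.
have b0 : 0 <= b.
  have [_ _ _ _ [K1 _ _]] := bK.
  exact: le_trans (normr_ge0 _) (ler_trprod_body_norm X bK K1).
(* Strictly between [b] and [N X]: thus [r^-1 *: X] lies outside the unit ball, while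
   [s * b < s * r] gives the final contradiction. *)
pose r := (b + N X) / 2.
have r0 : 0 < r by rewrite /r; lra.
pose B : set V := [set Y | N Y <= 1].
have clB : closed B.
  have /continuous_closedP h := is_norm_continuous.
  exact: (h [set r | r <= 1] (@closed_le _ _)).
have cvB : convex_set (B : set (convex_lmodType V)).
  apply/convex_setP => Y Y' t KY KY' /andP[t0 t1]; rewrite /B /=.
  apply: le_trans (ND _ _) _; rewrite !NZ !ger0_norm ?subr_ge0 //.
  by move: KY KY'; rewrite /B /=; nra.
have [] := @convex_separation B (r^-1 *: X) clB cvB.
- by exists 0; rewrite /B /= N0.
- by rewrite /B /= NZ normfV gtr0_norm // ler_pdivrMl // mulr1 /r; lra.
move=> Z [s0 [hs0 lt_s0]].
have s0_ge0 : 0 <= s0 by have := hs0 0; rewrite trprod0r; apply; rewrite /B /= N0.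
(* [s0] itself may vanish; moving it towards [Tr Z X / r] allows the normalization
   of [Z]. *)
pose s := (s0 + trprod Z (r^-1 *: X)) / 2.
have sp : 0 < s by rewrite /s; lra.
have hs Y : B Y -> trprod Z Y <= s by move=> /hs0; rewrite /s; lra.
have lt_s : s * r < trprod Z X.
  have : s < trprod Z (r^-1 *: X) by rewrite /s; lra.
  by rewrite trprodZr ltr_pdivlMl // mulrC.
have NZs Y : trprod Z Y <= s * N Y.
  have [->|Y0] := eqVneq Y 0; first by rewrite trprod0r N0 mulr0.
  have NY : 0 < N Y.
    rewrite lt0r is_norm_ge0 andbT; apply: contra Y0 => /eqP NY0.
    by have [_ _ h] := normN; rewrite (h _ NY0).
  have := hs ((N Y)^-1 *: Y); rewrite trprodZr ler_pdivrMl // mulrC; apply.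
  by rewrite /B /= NZ normfV gtr0_norm // mulVf // gt_eqF.
have : trprod X (s^-1 *: Z) <= b.
  apply: ub; exists (s^-1 *: Z) => // Y.
  by rewrite trprodZr ler_pdivrMl // trprodC.
rewrite trprodZr ler_pdivrMl // trprodC => h.
have : s * b < s * r by rewrite ltr_pM2l // /r; lra.
by lra.
Qed.

Hypothesis N_trace : forall X, `|trprod X I1| <= N X.
Hypothesis N_rank1 : forall u, N (rank1 u) <= trprod I1 (rank1 u).

(** [N_trace] puts both signs of the identity into the dual ball; testing [M] and [- M] on [u u^*]
    with [N_rank1] confines it to the operator interval. *)
Lemma dual_ball_body : measurement_bodies dual_ball.
Proof.
have K1 : dual_ball I1 by move=> X; apply: le_trans (ler_norm _) _.
split; first exact: dual_ball_full.
- apply/seteqP; split=> [M KM|_ [M KM <-]]; last exact: dual_ball_symmetric.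
  by exists (- M); [exact: dual_ball_symmetric | rewrite opprK].
- exact: dual_ball_closed.
- exact: dual_ball_convex.
split=> //; first exact: dual_ball_symmetric.
move=> M KM; split; apply/psdP => u; rewrite trprodBl ?trprodNl.
  have := dual_ball_symmetric KM (rank1 u); rewrite trprodC trprodNl.
  by have := N_rank1 u; lra.
by have := KM (rank1 u); rewrite trprodC; have := N_rank1 u; lra.
Qed.

End Norm.

(** * Comparison of bodies through support functions *)

Lemma body_norm_subset (K K' : set V) : measurement_bodies K ->
  measurement_bodies K' -> (forall X, body_norm K X <= body_norm K' X) -> K `<=` K'.
Proof.
move=> bK bK' leN M KM; apply: contrapT => nKM.
have [_ _ clK' cvK' [K'1 _ _]] := bK'.
(* At the separating [Z] the support function of [K] would exceed that of [K']. *)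
have [|Z [b [hb]]] := convex_separation clK' cvK' _ nKM; first by exists I1.
rewrite ltNge => /negP; apply.
have [[M' K'M' eqM'] _] := body_norm_max bK' Z.
have [_ ub] := body_norm_max bK Z.
by apply: le_trans (hb _ K'M'); rewrite eqM' (le_trans _ (leN Z)) //; apply: ub; exists M.
Qed.

(** * From bodies to binary POVMs *)

Lemma norm_half_sum_diff (a b n : R) : `|a| <= n -> `|b| <= n ->
  `|2^-1 * (a + b)| + `|2^-1 * (a - b)| <= n.
Proof.
rewrite !ler_norml => /andP[? ?] /andP[? ?].
by case: (ger0P (2^-1 * (a + b))) => ?; case: (ger0P (2^-1 * (a - b))) => ?; lra.
Qed.

Definition two_outcome_effect (M : V) (k : 'I_2) : V :=
  2^-1 *: (if k == 0 then I1 + M else I1 - M).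

Lemma two_outcome_psd (M : V) : unit_interval M ->
  forall k, psd (two_outcome_effect M k).
Proof.
move=> [/psdP hM1 /psdP hM2] k; apply/psdP => u; rewrite trprodZl.
have := hM1 u; have := hM2 u; rewrite !trprodBl trprodNl => h2 h1.
by case: ifP => _; rewrite ?trprodBl ?trprodDl; lra.
Qed.

Lemma two_outcome_sum (M : V) : \sum_k two_outcome_effect M k = I1.
Proof.
rewrite big_ord_recl big_ord1 /two_outcome_effect /= -scalerDr addrACA subrr addr0.
by rewrite -mulr2n -(scaler_nat 2 I1) scalerA mulVf ?scale1r // pnatr_eq0.
Qed.

Definition two_outcome (M : V) (hM : unit_interval M) : povm R d :=
  Povm (two_outcome_psd hM) (two_outcome_sum M).

Lemma two_outcome_trprod (M : V) (hM : unit_interval M) X :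
  \sum_k `|trprod X (effect (two_outcome hM) k)| =
  `|2^-1 * (trprod X I1 + trprod X M)| + `|2^-1 * (trprod X I1 - trprod X M)|.
Proof.
rewrite [LHS]big_ord_recl [X in _ + X = _]big_ord1 /= /two_outcome_effect /=.
by rewrite !trprodZr trprodDr trprodBr.
Qed.

(** Moving an interior point of [K] slightly in the direction [X] changes its pairing with [X] by a
    positive multiple of [trprod X X]. *)
Lemma full_dimensional_separates (K : set V) X : full_dimensional K ->
  (forall M, K M -> trprod X M = 0) -> X = 0.
Proof.
move=> [M0 /nbhs_ballP[e /= e0 Ke]] X0; apply/eqP; apply: contraT => Xn0.
have Xp : 0 < `|X| by rewrite normr_gt0.
pose t := e / 2 / `|X|.
have t0 : 0 < t by rewrite !divr_gt0.
have KM0 : K M0 by apply: Ke; exact: ballxx.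
have KM : K (M0 + t *: X).
  apply: Ke; rewrite -ball_normE /= opprD addNKr normrN normrZ gtr0_norm //.
  by rewrite /t divfK ?gt_eqF // ltr_pdivrMr // ltr_pMr // ltr1n.
have := X0 _ KM; rewrite trprodDr (X0 _ KM0) add0r trprodZr => /eqP.
rewrite mulf_eq0 gt_eqF //= => /eqP/trprodXX_eq0 XX.
by move: Xn0; rewrite XX eqxx.
Qed.

Lemma body_norm_povm (K : set V) : measurement_bodies K ->
  exists2 MM : set (povm R d), separating MM & povm_norm MM = body_norm K.
Proof.
move=> bK; have [fK _ _ _ [K1 _ Ksub]] := bK.
(* The largest candidate is taken, all POVMs dominated by [body_norm K]: the upper bound then holds
   by definition, and only membership of the binary POVMs is to be checked. *)
pose MM : set (povm R d) :=
  [set E | forall X, \sum_k `|trprod X (effect E k)| <= body_norm K X].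
have MM_two M (KM : K M) : MM (two_outcome (Ksub M KM)).
  move=> X; rewrite two_outcome_trprod.
  by apply: norm_half_sum_diff; exact: ler_trprod_body_norm.
exists MM.
  move=> X Xn0; apply: contrapT => hX; move/eqP: Xn0; apply.
  apply: full_dimensional_separates fK _ => M KM.
  have h k : trprod X (effect (two_outcome (Ksub M KM)) k) = 0.
    apply/eqP; apply: contrapT => /negP hk; apply: hX.
    by exists (two_outcome (Ksub M KM)) => //; exists k.
  (* The two effects differ by [M], so [X] is orthogonal to [M]. *)
  have := h ord0; have := h ord_max; rewrite /= /two_outcome_effect /=.
  by rewrite !trprodZr !trprodDr trprodNr; lra.
apply/funext => X; apply/eqP; rewrite eq_le; apply/andP; split.
  apply: povm_norm_le => [|E]; last by apply.
  exact: le_trans (normr_ge0 _) (ler_trprod_body_norm X bK K1).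
have [[M KM <-] _] := body_norm_max bK X.
apply: le_trans (povm_norm_ub X (MM_two M KM)); rewrite two_outcome_trprod.
set a := trprod X I1; set b := trprod X M.
(* These signs are chosen since the half sum minus the half difference is [b]. *)
have := ler_norm (2^-1 * (a + b)); have := ler_norm (- (2^-1 * (a - b))).
by rewrite normrN; lra.
Qed.

(** * The trace norm of rank-one operators *)

Lemma trace_mxsqrt (B : 'M[C]_d) : \tr (mxsqrt B) = \sum_i sqrtC (spectral_diag B 0 i).
Proof.
rewrite /mxsqrt mxtrace_mulC mulmxA mulmxV ?spectral_unit // mul1mx mxtrace_diag.
by apply: eq_bigr => i _; rewrite mxE.
Qed.

(** With [A = u u^*] and [c = u^* u], the matrix [B = A^* A = c A] satisfies [B^2 = c^2 B]. Its
    eigenvalues are therefore 0 or [c^2], so [c] times the root of each is the eigenvalue itself,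
    and these sum to [c^2]. *)
Lemma trnorm_rank1 u : trnorm (rank1 u) = trprod I1 (rank1 u).
Proof.
rewrite trprod1_rank1 /trnorm.
set A := hermmx (rank1 u); set c := (u^t* *m u) 0 0.
have c0 : 0 <= c.
  by rewrite /c mxE; apply: sumr_ge0 => i _; rewrite !mxE mulrC mul_conjC_ge0.
have hA : A^t* = A by have /herm_predP <- := herm_inP (rank1 u).
have AA : A *m A = c *: A.
  rewrite /A /= mulmxA -(mulmxA u) [u^t* *m u]mx11_scalar -/c.
  by rewrite mul_mx_scalar -scalemxAl.
have trA : \tr A = c by rewrite /A /= mxtrace_mulC /mxtrace big_ord1.
rewrite hA AA; set B := c *: A.
have hB : B^t* = B by rewrite /B -AA trmx_mul map_mxM hA.
have BB : B *m B = c ^+ 2 *: B.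
  by rewrite /B -scalemxAl -scalemxAr AA !scalerA.
have normB : B \is normalmx by apply/normalmxP; rewrite hB.
have /orthomx_spectralP Bdiag := normB.
rewrite trace_mxsqrt; set s := spectral_diag B in Bdiag *; set P := spectralmx B in Bdiag *.
have Pu : P \in unitmx by exact: spectral_unit.
have trs : \sum_i s 0 i = c ^+ 2.
  rewrite -mxtrace_diag expr2 -{2}trA -mxtraceZ -/B Bdiag.
  by rewrite mxtrace_mulC mulmxA mulmxV // mul1mx.
have eigen i : s 0 i ^+ 2 = c ^+ 2 * s 0 i.
  have : diag_mx s *m diag_mx s = c ^+ 2 *: diag_mx s.
    have -> : diag_mx s = P *m B *m invmx P.
      by rewrite Bdiag !mulmxA mulmxV // mul1mx mulmxK.
    rewrite !mulmxA mulmxKV // -(mulmxA P B B) BB.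
    by rewrite -scalemxAr -scalemxAl.
  move=> /matrixP/(_ i i); rewrite mulmx_diag !mxE eqxx !mulr1n.
  by rewrite expr2.
(* The factor [c] is cancelled below; if it is 0, every eigenvalue has square 0. *)
congr complex.Re; have [cz|cn] := eqVneq c 0.
  rewrite cz big1 // => i _; have /eqP := eigen i.
  by rewrite cz expr0n /= mul0r sqrf_eq0 => /eqP ->; rewrite sqrtC0.
apply: (mulfI cn); rewrite mulr_sumr -expr2 -trs; apply: eq_bigr => i _.
have /eqP := eigen i; rewrite expr2 -subr_eq0 -mulrBl mulf_eq0 subr_eq0.
case/orP => /eqP ->; last by rewrite sqrtC0 mulr0.
by rewrite sqrCK.
Qed.

(** The bound is asked on rank-one operators only, so that it applies both to POVM norms, for
    surjectivity, and to norms dominated by the trace norm. *)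
Lemma norm_eq_body_norm (N : V -> R) : is_norm N ->
  (forall X, `|trprod X I1| <= N X) -> (forall u, N (rank1 u) <= trprod I1 (rank1 u)) ->
  exists2 K : set V, measurement_bodies K & body_norm K = N.
Proof.
move=> normN tr1 rk1; have bK := dual_ball_body normN tr1 rk1.
by exists (dual_ball N) => //; apply/funext => X; exact: body_norm_dual_ball.
Qed.

End Herm.

(* In the last clause, `|Tr xi| <= N xi says that 1 and -1 lie in the dual unit
   ball of N. It cannot be dropped: half of the trace norm is a norm bounded by
   the trace norm, but it is 1 / 2 on density operators, where every povm_norm of
   a nonempty set of POVMs is 1. *)
Theorem theorem4 (R : realType) (d : nat) :
  [/\ set_bij (@measurement_bodies R d) (@povm_norms R d) (@body_norm R d),
      (forall K : set (herm R d), measurement_bodies K ->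
        forall xi : herm R d,
          is_max [set trprod xi M | M in K] (body_norm K xi))
    & (forall N : herm R d -> R,
        is_norm N ->
        (forall xi : herm R d, `|trprod xi (herm1 R d)| <= N xi) ->
        (forall xi : herm R d, N xi <= trnorm xi) ->
        exists MM : set (povm R d), forall xi : herm R d, N xi = povm_norm MM xi)].
Proof.
split; [split| |].
- by move=> K bK; have [MM sepM eqN] := body_norm_povm bK; exists MM.
- move=> K K' /set_mem bK /set_mem bK' eqN; apply/seteqP.
  by split; apply: body_norm_subset => // X; rewrite eqN.
- move=> _ [MM sepM <-].
  have [||K bK eqN] := norm_eq_body_norm (povm_norm_is_norm sepM); last by exists K.
    by move=> X; exact: povm_norm_trace.
  by move=> u; exact: povm_norm_rank1.
- by move=> K bK xi; exact: body_norm_max.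
- move=> N normN tr1 trN.
  have [//|u|K bK eqN] := norm_eq_body_norm normN.
    by rewrite -trnorm_rank1.
  have [MM _ eqM] := body_norm_povm bK.
  by exists MM => xi; rewrite eqM eqN.
Qed.
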